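(* Let $X$ be a finite cubical complex, $i\ge1$, $q\ge2$ an integer and $p\in[0,1]$. Then the plaquette random-cluster measure $\mu_{X,p,q,i}$ is positively associated, in the sense that for any two increasing events $A$ and $B$, $$\mu_{X,p,q,i}(A\cap B)\ge\mu_{X,p,q,i}(A)\,\mu_{X,p,q,i}(B).$$
   Context: $X^{(k)}$ denotes the union of the cells of $X$ of dimension at most $k$, and $|X^{(i)}|$ the number of $i$-cells ($i$-plaquettes) of $X$. An $i$-dimensional percolation subcomplex $P$ of $X$ is a subcomplex with $X^{(i-1)}\subset P\subset X^{(i)}$; $|P|$ is its number of $i$-plaquettes. The $i$-dimensional plaquette random-cluster measure on $X$ with coefficients in $\mathbb{Z}_q=\mathbb{Z}/q\mathbb{Z}$ is the probability measure on percolation subcomplexes $$\mu_{X,p,q,i}(P)\propto p^{|P|}(1-p)^{|X^{(i)}|-|P|}\,|H^{i-1}(P;\mathbb{Z}_q)|.$$ An event (set of percolation subcomplexes) $A$ is increasing if $P\in A$ and $P\subset P'$ imply $P'\in A$. *)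

(* Defs.v *)
From HB Require Import structures.
From mathcomp Require Import all_boot all_order all_algebra.
From mathcomp Require Import reals.

Set Implicit Arguments.
Unset Strict Implicit.
Unset Printing Implicit Defensive.

Import Order.TTheory GRing.Theory Num.Theory.
Local Open Scope ring_scope.

(* A nonempty face of the cube [0,1]^n is coded by f : n.-tuple (option bool):
   its k-th coordinate is fixed to e when the k-th entry is Some e (true for 1,
   false for 0), and is free when that entry is None. *)
Definition cube_subface n (f g : n.-tuple (option bool)) : bool :=
  [forall k : 'I_n, (tnth g k == None) || (tnth f k == tnth g k)].

(* A finite cubical complex (with embedded closed cells), given by its finite
   set of nonempty cells ordered by "y is a face of x". The chart of x
   parametrizes x by the cube of dimension [dim x]: it identifies the faces of
   x with the nonempty faces of that cube. It is injective on the faces of x by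
   antisymmetry of the order. Its values on cells that are not faces of x are
   irrelevant. Charts of different cells are chosen independently; they serve
   as orientations. *)
Record cubical_complex := CubicalComplex {
  cell_disp : Order.disp_t;
  cell :> finPOrderType cell_disp;
  dim : cell -> nat;
  chart : forall x : cell, cell -> (dim x).-tuple (option bool);
  chart_mono : forall x y z : cell, (y <= x)%O -> (z <= x)%O ->
    cube_subface (chart x y) (chart x z) = (y <= z)%O;
  chart_surj : forall (x : cell) (f : (dim x).-tuple (option bool)),
    exists2 y : cell, (y <= x)%O & chart x y = f }.

Section Cohomology.
Variable X : cubical_complex.
Implicit Types (x y : X) (P : {set X}).

Definition coord x y (k : nat) : option bool := nth None (chart x y) k.

(* For a facet y of x, the l-th component, in the coordinates of x, of the
   outward unit normal to y. *)
Definition outward x y (l : nat) : int :=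
  if coord x y l is Some e then (if e then 1 else -1) else 0.

(* For y a face of x, the partial derivative of the l-th coordinate of x along
   the r-th coordinate of y: the two agree on y, are exchanged by t |-> 1 - t,
   or are unrelated. *)
Definition transition x y (r l : nat) : int :=
  if [forall (z : X | (z <= y)%O), coord x z l == coord y z r] then 1
  else if [forall (z : X | (z <= y)%O), coord x z l == omap negb (coord y z r)]
  then -1 else 0.

(* Incidence number [x : y] for the convention "outward normal first": it is
   the orientation, with respect to the chart of x, of the frame consisting of
   the outward normal to y followed by the coordinate vectors of y. *)
Definition incidence x y : int :=
  if (y <= x)%O && (dim x == (dim y).+1) then
    \det (\matrix_(r < dim x, l < dim x)
            if nat_of_ord r is r'.+1 then transition x y r' l
            else outward x y l)
  else 0.

Definition subcomplex P : bool :=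
  [forall x in P, forall (y : X | (y <= x)%O), y \in P].

Definition skeleton (k : nat) : {set X} := [set x | (dim x <= k)%N].

Definition cells_of_dim (k : nat) P : {set X} := [set x in P | dim x == k].

(* Cochains of P with coefficients in Z/q are represented by functions on all
   the cells of X that vanish outside the k-cells of P. Recall that 'Z_q is Z/q
   for q >= 2. *)
Definition cochains (q k : nat) P : {set {ffun X -> 'Z_q}} :=
  [set f : {ffun X -> 'Z_q} |
    [forall x, (x \notin cells_of_dim k P) ==> (f x == 0)]].

Definition coboundary (q : nat) P (f : {ffun X -> 'Z_q}) : {ffun X -> 'Z_q} :=
  [ffun x => if x \in P then \sum_(y in P) (incidence x y)%:~R * f y else 0].

Definition cocycles (q k : nat) P : {set {ffun X -> 'Z_q}} :=
  [set f in cochains q k P | coboundary P f == 0].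

Definition coboundaries (q k : nat) P : {set {ffun X -> 'Z_q}} :=
  if k is k'.+1 then [set coboundary P g | g in cochains q k' P]
  else [set (0 : {ffun X -> 'Z_q})].

(* The underlying set of the quotient group of cocycles by coboundaries, as a
   set of cosets. In degree 0 this is unreduced cohomology. *)
Definition cohomology (q k : nat) P : {set {set {ffun X -> 'Z_q}}} :=
  [set [set (f : {ffun X -> 'Z_q}) + b
         | b : {ffun X -> 'Z_q} in coboundaries q k P]
    | f : {ffun X -> 'Z_q} in cocycles q k P].

End Cohomology.

Definition is_percolation (X : cubical_complex) (i : nat) (P : {set X}) :=
  [&& subcomplex P, skeleton X i.-1 \subset P & P \subset skeleton X i].

(* Only meaningful for i >= 1, because of the truncated predecessor. *)
Definition percolation (X : cubical_complex) (i : nat) : finType :=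
  {P : {set X} | is_percolation i P}.

Definition increasing (X : cubical_complex) (i : nat)
    (A : {set percolation X i}) : Prop :=
  forall P P' : percolation X i, P \in A -> sval P \subset sval P' -> P' \in A.

Section RandomCluster.
Variables (R : realType) (X : cubical_complex) (p : R) (q i : nat).

Definition prc_weight (P : percolation X i) : R :=
  let nP := #|cells_of_dim i (sval P)| in
  let nX := #|cells_of_dim i [set: X]| in
  p ^+ nP * (1 - p) ^+ (nX - nP) * #|cohomology q i.-1 (sval P)|%:R.

Definition prc_measure (A : {set percolation X i}) : R :=
  (\sum_(P in A) prc_weight P) / (\sum_(P : percolation X i) prc_weight P).

End RandomCluster.

(* Main.v *)
(* The weight of a percolation subcomplex is log-supermodular on the distributive
   lattice of percolation subcomplexes, so the four functions theorem of Ahlswede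
   and Daykin applies. The plaquette counts are modular. The (i-1)-coboundaries B
   do not depend on P and, since the coboundary squares to zero, are contained in
   the cocycles Z(P), so that |H^{i-1}(P)| = |Z(P)| / |B|. Finally
   Z(P) :&: Z(P') is Z(P :|: P') and Z(P) + Z(P') is contained in Z(P :&: P'), and
   |G| |H| = |G + H| |G :&: H| for subgroups.

   That the coboundary squares to zero is a computation with determinants. Let
   N_xz be the row of outward signs of z in the chart of x (when z has codimension
   two, it has two nonzero entries) and T_xz the matrix of the change of
   coordinates. Then T_yz T_xy = T_xz and N_yz T_xy = N_xz - N_xy, whence
   [x : y] [y : z] = det (N_xy; N_xz; T_xz). Summing over the facets y of x that
   contain z turns N_xy into N_xz, and two rows become equal. *)
Require Import Defs.
From HB Require Import structures.
From mathcomp Require Import all_boot all_order all_fingroup all_algebra.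
From mathcomp Require Import reals.
From mathcomp Require Import zify ring lra.
(* Makes [dim] the dimension of a cell again, and not that of a vector space. *)
Import Defs.
Set Implicit Arguments.
Unset Strict Implicit.
Unset Printing Implicit Defensive.
Import Order.TTheory GRing.Theory Num.Theory.
Local Open Scope ring_scope.

(** * Changes of charts *)

Section Incidence.
Variable X : cubical_complex.
Implicit Types x y z : X.

Lemma coord_default x y k : (dim x <= k)%N -> coord x y k = None.
Proof. by move=> le_xk; rewrite /coord nth_default ?size_tuple. Qed.

Lemma coord_le x y z k e : (z <= y)%O -> (y <= x)%O ->
  coord x y k = Some e -> coord x z k = Some e.
Proof.
move=> zy yx; have [lt_kx|/coord_default -> //] := ltnP k (dim x).
have := chart_mono (le_trans zy yx) yx.
rewrite zy => /forallP/(_ (Ordinal lt_kx)).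
by rewrite !(tnth_nth None) -!/(coord _ _ _) /= => /orP[]/eqP -> .
Qed.

Lemma le_coord x y z : (z <= x)%O -> (y <= x)%O ->
  (forall k e, coord x y k = Some e -> coord x z k = Some e) -> (z <= y)%O.
Proof.
move=> zx yx le_zy; rewrite -(chart_mono zx yx); apply/forallP => k.
rewrite !(tnth_nth None) -!/(coord _ _ _).
by case yk: (coord x y k) => [e|//]; rewrite (le_zy _ _ yk) eqxx.
Qed.

Lemma ex_face x (f : nat -> option bool) :
  exists2 y, (y <= x)%O & forall k, (k < dim x)%N -> coord x y k = f k.
Proof.
have [y yx yf] := chart_surj [tuple f k | k < dim x].
exists y => // k lt_kx; rewrite /coord yf.
by rewrite -[k]/(nat_of_ord (Ordinal lt_kx)) -tnth_nth tnth_mktuple.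
Qed.

Lemma coord_top x k : coord x x k = None.
Proof.
have [u ux uN] := ex_face x (fun=> None).
have xu : (x <= u)%O.
  apply: (le_coord (lexx x) ux) => l e.
  have [/uN -> //|/coord_default -> //] := ltnP l (dim x).
have [/uN|/coord_default -> //] := ltnP k (dim x).
by have /le_anti -> : (u <= x <= u)%O by rewrite ux xu.
Qed.

Lemma ex_facet x y l e : (y <= x)%O -> (l < dim x)%N -> coord x y l = None ->
  exists2 a, (a <= y)%O &
    forall k, coord x a k = if k == l then Some e else coord x y k.
Proof.
move=> yx lx yl.
have [a ax aE] := ex_face x (fun k => if k == l then Some e else coord x y k).
have {}aE k : coord x a k = if k == l then Some e else coord x y k.
  have [/aE //|kx] := ltnP k (dim x).
  by rewrite !coord_default //; case: eqP => // kl; move: lx; rewrite -kl ltnNge kx.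
exists a => //; apply: (le_coord ax yx) => k e' yk.
by rewrite aE yk; case: eqP yk yl => // -> ->.
Qed.

(** Since the face order does not depend on a chart, this lets coordinate values be compared between
    charts. *)
Lemma le_facet x y z a l e : (z <= y)%O -> (y <= x)%O -> (a <= y)%O ->
  (forall k, coord x a k = if k == l then Some e else coord x y k) ->
  (z <= a)%O <-> coord x z l = Some e.
Proof.
move=> zy yx ay aE; split=> [za|zl].
  by apply: (coord_le za (le_trans ay yx)); rewrite aE eqxx.
apply: (le_coord (le_trans zy yx) (le_trans ay yx)) => k e'.
rewrite aE; case: eqP => [-> [<-] //|_]; exact: coord_le.
Qed.

(* Facets are the coatoms of the face order, hence are preserved by changes of
   charts. *)
Lemma facet_change x y a l e : (y <= x)%O -> (a <= y)%O ->
  coord x y l = None ->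
  (forall k, coord x a k = if k == l then Some e else coord x y k) ->
  exists r e', (r < dim y)%N /\
    forall k, coord y a k = if k == r then Some e' else None.
Proof.
move=> yx ay yl aE.
have [r] : exists r : 'I_(dim y), coord y a r != None.
  apply/existsP; apply: contraT; rewrite negb_exists => /forallP aN.
  have ya : (y <= a)%O.
    apply: (le_coord (lexx y) ay) => k e'.
    have [ky|/coord_default -> //] := ltnP k (dim y).
    by move: (aN (Ordinal ky)); rewrite negbK /= => /eqP ->.
  have := aE l; rewrite eqxx.
  by rewrite (@le_anti _ _ a y) ?ay ?ya // yl.
case ar: (coord y a r) => [e'|//] _.
(* The facet [b] of [y] contains [a]. In the chart of [x] it can fix, beyond what [y] fixes, only
   [l]; if it did not, it would be all of [y]. *)
have [b bY bE] := ex_facet e' (lexx y) (ltn_ord r) (coord_top y r).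
have ab : (a <= b)%O by apply/(le_facet ay (lexx y) bY bE).
exists r, e'; split=> // k; suff -> : a = b by rewrite bE coord_top.
apply: le_anti; rewrite ab /=.
apply/(le_facet bY yx ay aE).
case bl: (coord x b l) => [e1|].
  by have := coord_le ab (le_trans bY yx) bl; rewrite aE eqxx => ->.
suff yb : (y <= b)%O.
  have br : coord y b r = Some e' by rewrite bE eqxx.
  by have := coord_le yb bY br; rewrite coord_top.
apply: (le_coord yx (le_trans bY yx)) => k' e1 bk.
have := coord_le ab (le_trans bY yx) bk; rewrite aE.
by case: eqP => // kl; move: bk; rewrite kl bl.
Qed.

(** The facets of [y] where [l] is 1 and 0 share no face, and two such facets of a cube are
    opposite: in the chart of [y] they come from one coordinate [r], with opposite values. By
    [le_facet] they determine both coordinates on every face of [y]. *)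
Lemma coord_change x y l : (y <= x)%O -> (l < dim x)%N -> coord x y l = None ->
  exists (r : 'I_(dim y)) (s : bool),
    forall z, (z <= y)%O -> coord x z l = omap (addb s) (coord y z r).
Proof.
move=> yx lx yl.
have [a ay aE] := ex_facet true yx lx yl.
have [b bY bE] := ex_facet false yx lx yl.
have [r [e [ry arE]]] := facet_change yx ay yl aE.
have [r' [e' [r'y brE]]] := facet_change yx bY yl bE.
have ab z : (z <= a)%O -> (z <= b)%O -> False.
  move=> za zb.
  have /(le_facet (le_trans za ay) yx ay aE) := za.
  by have /(le_facet (le_trans za ay) yx bY bE) -> := zb.
have {}arE k : coord y a k = if k == r then Some e else coord y y k.
  by rewrite coord_top.
have {}brE k : coord y b k = if k == r' then Some e' else coord y y k.
  by rewrite coord_top.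
have rr' : r' = r.
  apply/eqP; apply: contraT => nrr'.
  (* If [r'] differed from [r], this face would lie in both facets. *)
  have [z zy zE] := ex_face y (fun k => if k == r then Some e else Some e').
  case: (ab z).
    by apply/(le_facet zy (lexx y) ay arE); rewrite zE ?eqxx.
  by apply/(le_facet zy (lexx y) bY brE); rewrite zE ?(negPf nrr').
subst r'.
have ee' : e' = ~~ e.
  have [ee'|] := eqVneq e e'; last by case: (e) (e') => [] [].
  case: (ab a) => //; apply/(le_facet ay (lexx y) bY brE).
  by rewrite arE eqxx ee'.
(* Adding [~~ e] sends [e], the value of [r] on [a], to [true], the value of [l] there. *)
subst e'; exists (Ordinal ry), (~~ e) => z zy /=.
have xa := iff_trans (iff_sym (le_facet zy yx ay aE))
                     (le_facet zy (lexx y) ay arE).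
have xb := iff_trans (iff_sym (le_facet zy yx bY bE))
                     (le_facet zy (lexx y) bY brE).
case: (coord x z l) xa xb => [[]|] [ha ha'] [hb hb'] /=.
- by rewrite ha //=; case: (e).
- by rewrite hb //=; case: (e).
case: (coord y z r) ha' hb' => [e1|//].
by case: (eqVneq e1 e) => [-> /(_ erefl)//|]; case: e1 (e) => [] [] // _ _ /(_ erefl).
Qed.

Lemma coord_change_inj x y (r r' : 'I_(dim y)) l s s' :
  (forall z, (z <= y)%O -> coord x z l = omap (addb s) (coord y z r)) ->
  (forall z, (z <= y)%O -> coord x z l = omap (addb s') (coord y z r')) ->
  r = r' /\ s = s'.
Proof.
move=> h h'.
have [a ay aE] := ex_facet true (lexx y) (ltn_ord r) (coord_top y r).
have := h a ay; rewrite h' // !aE eqxx coord_top.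
by case: eqP => //= /val_inj -> [] /addIb ->.
Qed.

Lemma transition_sign x y (r : 'I_(dim y)) l s :
  (forall z, (z <= y)%O -> coord x z l = omap (addb s) (coord y z r)) ->
  transition x y r l = (-1) ^+ s.
Proof.
move=> h; rewrite /transition.
have omapF (o : option bool) : omap (addb false) o = o by case: o.
case: ifP => [/forall_inP h'|].
  have h2 z : (z <= y)%O -> coord x z l = omap (addb false) (coord y z r).
    by move=> /h'/eqP ->; rewrite omapF.
  by have [_ ->] := coord_change_inj h h2.
case: s h => h; last first.
  by move/negP; case; apply/forall_inP => z /h ->; rewrite omapF.
by move=> _; rewrite ifT //; apply/forall_inP => z /h ->.
Qed.

Lemma transition_eq0 x y (r : 'I_(dim y)) l :
  (forall s, ~ forall z, (z <= y)%O ->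
     coord x z l = omap (addb s) (coord y z r)) -> transition x y r l = 0.
Proof.
move=> h; rewrite /transition; case: ifP => [/forall_inP h'|_].
  by case: (h false) => z /h'/eqP ->; case: coord.
by case: ifP => // /forall_inP h'; case: (h true) => z /h'/eqP.
Qed.

Lemma transition_fixed x y (r : 'I_(dim y)) l :
  coord x y l != None -> transition x y r l = 0.
Proof.
move=> yl; apply: transition_eq0 => s /(_ y (lexx y)).
by rewrite coord_top /= => /eqP; rewrite (negPf yl).
Qed.

(** The column of a free coordinate is a signed unit vector, so a product with it keeps a single
    term. *)
Lemma transition_col x y l : (y <= x)%O -> (l < dim x)%N ->
  coord x y l = None -> exists (r : 'I_(dim y)) s,
  (forall z, (z <= y)%O -> coord x z l = omap (addb s) (coord y z r)) /\
  forall h : 'I_(dim y) -> int,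
    \sum_k h k * transition x y k l = h r * (-1) ^+ s.
Proof.
move=> yx lx yl; have [r [s rs]] := coord_change yx lx yl.
exists r, s; split=> // h; rewrite (bigD1 r) //= (transition_sign rs).
rewrite big1 ?addr0 // => k nkr; rewrite (@transition_eq0 _ _ k) ?mulr0 //.
by move=> s' ks'; have [rk _] := coord_change_inj rs ks'; rewrite rk eqxx in nkr.
Qed.

Lemma outward_transition x y z l : (z <= y)%O -> (y <= x)%O -> (l < dim x)%N ->
  \sum_(k < dim y) outward y z k * transition x y k l =
  outward x z l - outward x y l.
Proof.
move=> zy yx lx; case yl: (coord x y l) => [e|].
  rewrite /outward (coord_le zy yx yl) yl subrr big1 // => k _.
  by rewrite transition_fixed ?yl ?mulr0.
have [r [s [rs ->]]] := transition_col yx lx yl.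
rewrite /outward yl rs // subr0; case: coord => [e|]; last by rewrite mul0r.
by case: s {rs} e => [] [] /=; rewrite ?expr0 ?expr1.
Qed.

(** Composing changes of coordinates adds the flips in [bool], hence multiplies the signs; a
    coordinate fixed on [z] gives a zero column on both sides. *)
Lemma transition_comp x y z l (j : 'I_(dim z)) :
  (z <= y)%O -> (y <= x)%O -> (l < dim x)%N ->
  \sum_(k < dim y) transition y z j k * transition x y k l = transition x z j l.
Proof.
move=> zy yx lx; case yl: (coord x y l) => [e|].
  rewrite transition_fixed ?(coord_le zy yx yl) // big1 // => k _.
  by rewrite (transition_fixed k) ?yl ?mulr0.
have [r [s [rs ->]]] := transition_col yx lx yl.
case zr: (coord y z r) => [e|].
  by rewrite !transition_fixed ?mul0r // ?rs // zr.
have [j' [s' j's']] := coord_change zy (ltn_ord r) zr.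
have j's z' : (z' <= z)%O ->
    coord x z' l = omap (addb (s (+) s')) (coord z z' j').
  move=> z'z; rewrite rs ?(le_trans z'z) // j's' //.
  by case: coord => //= e; rewrite addbA.
have [<-|njj'] := eqVneq j' j.
  by rewrite (transition_sign j's') (transition_sign j's) signr_addb mulrC.
rewrite !transition_eq0 ?mul0r // => s1 h.
  by have [E _] := coord_change_inj j's h; rewrite E eqxx in njj'.
by have [E _] := coord_change_inj j's' h; rewrite E eqxx in njj'.
Qed.

(** Agreeing on [y] up to a flip is a bijection between the coordinates of [y] and the coordinates
    of [x] that are free on [y]. *)
Lemma dim_face x y : (y <= x)%O ->
  dim y = #|[set l : 'I_(dim x) | coord x y l == None]|.
Proof.
move=> yx; pose rel (l : 'I_(dim x)) (r : 'I_(dim y)) :=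
  [exists s, [forall (z : X | (z <= y)%O),
     coord x z l == omap (addb s) (coord y z r)]].
have relP (l : 'I_(dim x)) (r : 'I_(dim y)) : reflect (exists s, forall z, (z <= y)%O ->
    coord x z l = omap (addb s) (coord y z r)) (rel l r).
  apply: (iffP existsP) => -[s h]; exists s.
    by move=> z zy; apply/eqP; move: z zy; apply/forall_inP.
  by apply/forall_inP => z zy; apply/eqP/h.
have rel_fun l r r' : rel l r -> rel l r' -> r = r'.
  by move=> /relP[s h] /relP[s' h']; have [] := coord_change_inj h h'.
have rel_inj (l l' : 'I_(dim x)) r : coord x y l = None -> rel l r -> rel l' r -> l = l'.
  move=> yl /relP[s h] /relP[s' h'].
  have [a ay aE] := ex_facet true yx (ltn_ord l) yl.
  have := h' a ay; have := h a ay; rewrite !aE eqxx.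
  case: (coord y a r) => //= e _; case: eqP => [/val_inj -> //|_] yl'.
  by have := h' y (lexx y); rewrite yl' coord_top.
have free (l : 'I_(dim x)) r : rel l r -> coord x y l = None.
  by move=> /relP[s /(_ y (lexx y))]; rewrite coord_top.
have rel_tot r : exists l, rel l r.
  (* The proper face [a] of [y] fixes some [l] that is free on [y]. In the chart of [y] it fixes
     only [r], so [l] can only correspond to [r]. *)
  have [a ay aE] := ex_facet true (lexx y) (ltn_ord r) (coord_top y r).
  have [l yl al] : exists2 l : 'I_(dim x), coord x y l = None & coord x a l != None.
    have [/existsP[l /andP[/eqP yl al]]|/existsPn h] := boolP [exists l : 'I_(dim x),
        (coord x y l == None) && (coord x a l != None)]; first by exists l.
    have ya : (y <= a)%O.
      apply: (le_coord yx (le_trans ay yx)) => k e ak.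
      have kx : (k < dim x)%N by rewrite ltnNge; apply: contraPN ak => /coord_default ->.
      case yk: (coord x y k) => [e'|].
        by rewrite -ak (coord_le ay yx yk).
      by have := h (Ordinal kx); rewrite /= yk ak.
    have ar : coord y a r = Some true by rewrite aE eqxx.
    by have := coord_le ya ay ar; rewrite coord_top.
  have [r' [s rs]] := coord_change yx (ltn_ord l) yl.
  suff <- : r' = r by exists l; apply/relP; exists s.
  move: al; rewrite rs // aE; case: ifP => [/eqP/val_inj <- //|_].
  by rewrite coord_top.
have rel_tot' (l : 'I_(dim x)) : coord x y l = None -> exists r, rel l r.
  by move=> /(coord_change yx (ltn_ord l)) [r rs]; exists r; apply/relP.
pose f r := xchoose (rel_tot r).
have fP r : rel (f r) r by exact: (xchooseP (rel_tot r)).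
have f_inj : injective f.
  by move=> r r' E; apply: rel_fun (fP r) _; rewrite E fP.
rewrite -[LHS]card_ord -(card_codom f_inj); apply: eq_card => l.
rewrite inE; apply/codomP/eqP => [[r ->]|/[dup] yl /rel_tot'[r lr]].
  exact: free (fP r).
by exists r; apply: rel_inj yl lr (fP r).
Qed.

End Incidence.

(** * The coboundary squares to zero *)

(** The second matrix is padded to a block matrix with diagonal blocks 1 and [G'], which keeps the
    first row of the other factor and acts on the remaining ones. *)
Lemma det_mul_lift (R : comNzRingType) m (F G : nat -> nat -> R) :
  \det (\matrix_(r < m.+1, l < m.+1) F r l) * \det (\matrix_(r < m, l < m) G r l)
  = \det (\matrix_(r < m.+1, l < m.+1)
      if nat_of_ord r is r'.+1 then \sum_(k < m) G r' k * F k.+1 l else F 0 l).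
Proof.
set G' := (X in _ * \det X).
have -> : \det G' = \det (block_mx 1%:M 0 0 G' : 'M_(1 + m)).
  by rewrite det_ublock det1 mul1r.
rewrite mulrC -[LHS](@det_mulmx _ (1 + m)).
congr (\det _); apply/matrixP => r l; rewrite !mxE big_split_ord big_ord1 /=.
rewrite -[r]/(r : 'I_(1 + m)); case: (fintype.splitP (r : 'I_(1 + m))) => r' rE.
  rewrite (_ : r = lshift m r'); last exact: val_inj.
  rewrite block_mxEul !mxE /= ord1 eqxx mul1r big1 ?addr0 // => k _.
  by rewrite block_mxEur mxE mul0r.
rewrite (_ : r = rshift 1 r'); last exact: val_inj.
rewrite block_mxEdl !mxE /= mul0r add0r; apply: eq_bigr => k _.
by rewrite block_mxEdr !mxE.
Qed.

Section Square.
Variable X : cubical_complex.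
Implicit Types x y z : X.

Lemma incidence_neq0 x y : incidence x y != 0 ->
  (y <= x)%O /\ dim x = (dim y).+1.
Proof. by rewrite /incidence; case: ifP => [/andP[-> /eqP]|]; rewrite ?eqxx. Qed.

(** By [dim_face] a face of codimension one fixes exactly one coordinate, so this coordinate and its
    value determine it. *)
Lemma eq_facet x y y' l : (y <= x)%O -> (y' <= x)%O ->
  dim x = (dim y).+1 -> dim x = (dim y').+1 ->
  coord x y l != None -> coord x y' l = coord x y l -> y = y'.
Proof.
move=> yx y'x dy dy' yl yy'.
have lx : (l < dim x)%N.
  by rewrite ltnNge; apply: contraNN yl => /coord_default ->.
have fixed u k : (u <= x)%O -> dim x = (dim u).+1 -> coord x u l != None ->
    coord x u k != None -> k = l.
  move=> ux; rewrite (dim_face ux) => du ul uk.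
  have kx : (k < dim x)%N.
    by rewrite ltnNge; apply: contraNN uk => /coord_default ->.
  pose S := [set l : 'I_(dim x) | coord x u l == None].
  have cS : #|~: S| = 1%N.
    by have := cardsC S; move: du; rewrite card_ord -/S; lia.
  have /cards1P[t St] : #|~: S| == 1%N by apply/eqP.
  have : Ordinal kx \in ~: S by rewrite !inE.
  have : Ordinal lx \in ~: S by rewrite !inE.
  by rewrite St !inE => /eqP <- /eqP[].
apply: le_anti; apply/andP; split.
  apply: (le_coord yx y'x) => k e yk.
  suff <- : l = k by rewrite -yy' -yk; congr coord; rewrite (fixed y' k) ?yy' ?yk.
  by rewrite (fixed y' k) ?yy' ?yk.
apply: (le_coord y'x yx) => k e yk.
suff <- : l = k by rewrite yy' -yk; congr coord; rewrite (fixed y k) ?yk.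
by rewrite (fixed y k) ?yk.
Qed.

Lemma ex_codim1 x z l e : (z <= x)%O -> coord x z l = Some e ->
  exists y, [/\ (z <= y)%O, (y <= x)%O, dim x = (dim y).+1 & coord x y l = Some e].
Proof.
move=> zx zl.
have lx : (l < dim x)%N.
  by rewrite ltnNge; apply: contraPN zl => /coord_default ->.
have [y yx yE] := ex_facet e (lexx x) lx (coord_top x l).
exists y; split=> //; last by rewrite yE eqxx.
  exact/(le_facet zx (lexx x) yx yE).
rewrite (dim_face yx).
pose S := [set l : 'I_(dim x) | coord x y l == None].
rewrite -/S -[LHS]card_ord -(cardsC S) addnC.
suff -> : ~: S = [set Ordinal lx] by rewrite cards1.
apply/setP => k; rewrite !inE yE coord_top -val_eqE /=.
by case: (nat_of_ord k == l).
Qed.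

(* The product of two incidence numbers does not see the chart of the
   intermediate cell, and depends on it only through the first row. *)
Lemma incidence_mul x y z : (z <= y)%O -> (y <= x)%O ->
  dim x = (dim y).+1 -> dim y = (dim z).+1 ->
  incidence x y * incidence y z =
  \det (\matrix_(r < dim x, l < dim x)
     if nat_of_ord r is r'.+1 then
       if r' is r''.+1 then transition x z r'' l else outward x z l
     else outward x y l).
Proof.
move=> zy yx dx dy; rewrite /incidence zy yx dx dy !eqxx /=.
rewrite -dy.
rewrite (det_mul_lift _ (fun r l : nat => if r is r'.+1 then transition x y r' l else outward x y l)
  (fun r l : nat => if r is r'.+1 then transition y z r' l else outward y z l)).
(* [M a] subtracts [a] times the first row from the second: the product is [M 1] and the goal is
   [M 0]. By linearity in row [i1] they differ by the determinant of [N], whose first two rows are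
   equal. *)
pose M a := \matrix_(r < (dim y).+1, l < (dim y).+1)
     if nat_of_ord r is r'.+1 then
       if r' is r''.+1 then transition x z r'' l else outward x z l - a * outward x y l
     else outward x y l.
transitivity (\det (M 1)).
  congr (\det _); apply/matrixP => r l; rewrite !mxE.
  have lx : (l < dim x)%N by rewrite dx.
  case: r => [[|[|r]] ry] //=; first by rewrite outward_transition ?mul1r.
  have rz : (r < dim z)%N by move: ry; rewrite dy.
  by rewrite (transition_comp (Ordinal rz)).
transitivity (\det (M 0)); last first.
  by congr (\det _); apply/matrixP => r l; rewrite !mxE; case: r => [[|[|r]] ry] //=; rewrite mul0r subr0.
have r1y : (1 < (dim y).+1)%N by rewrite dy.
pose i1 := Ordinal r1y.
pose N := \matrix_(r < (dim y).+1, l < (dim y).+1)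
     if nat_of_ord r is r'.+1 then
       if r' is r''.+1 then transition x z r'' l else outward x y l
     else outward x y l.
rewrite (@determinant_multilinear _ _ (M 1) (M 0) N i1 1 (-1)).
- rewrite (@determinant_alternate _ _ N ord0 i1) ?mulr0 ?addr0 ?mul1r //.
  by move=> l; rewrite !mxE.
- by apply/rowP => l; rewrite !mxE /=; ring.
- by apply/matrixP => r l; rewrite !mxE; have := neq_lift i1 r;
    case: (lift i1 r) => [[|[|k]] hk] //=.
- by apply/matrixP => r l; rewrite !mxE; have := neq_lift i1 r;
    case: (lift i1 r) => [[|[|k]] hk] //=.
Qed.

(** If [z] fixes [l], exactly one facet of [x] through [z] does too, with the same value; otherwise
    none does. *)
Lemma sum_outward x z l : (z <= x)%O ->
  \sum_(y : X | [&& (z <= y)%O, (y <= x)%O & dim x == (dim y).+1]) outward x y l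
  = outward x z l.
Proof.
move=> zx; case zl: (coord x z l) => [e|].
  have [y [zy yx dy yl]] := ex_codim1 zx zl.
  rewrite (bigD1 y) ?zy ?yx ?dy ?eqxx //= [outward x y l]/outward
    [outward x z l]/outward yl zl.
  rewrite big1 ?addr0 // => y' /andP[/and3P[zy' y'x /eqP dy'] ny'y].
  rewrite /outward; case y'l: coord => [e'|] //.
  case/eqP: ny'y; apply: (@eq_facet x _ _ l); rewrite ?y'l ?yl ?dy //.
  by rewrite -zl (coord_le zy' y'x y'l).
rewrite /outward zl big1 // => y /and3P[zy yx _].
case yl: coord => [e'|] //.
by have := coord_le zy yx yl; rewrite zl.
Qed.

Lemma sum_incidence_mul x z : \sum_y incidence x y * incidence y z = 0.
Proof.
have [/andP[zx /eqP dx]|nzx] :=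
  boolP ((z <= x)%O && (dim x == (dim z).+2)); last first.
  rewrite big1 // => y _; apply/eqP; apply: contraNT nzx.
  rewrite mulf_eq0 negb_or => /andP[/incidence_neq0[yx dx] /incidence_neq0[zy dy]].
  by rewrite (le_trans zy yx) dx dy eqxx.
pose M (v : nat -> int) := \matrix_(r < (dim z).+2, l < (dim z).+2)
  if nat_of_ord r is r'.+1 then
    if r' is r''.+1 then transition x z r'' l else outward x z l
  else v l.
(* Cofactors along the first row ignore that row, so they can be taken at [v = 0]. The determinant
   is thus linear in [v], which moves the sum over facets into the first row. *)
have detM v : \det (M v) = \sum_(l < (dim z).+2) v l * cofactor (M (fun=> 0)) ord0 l.
  rewrite (expand_det_row _ ord0); apply: eq_bigr => l _.
  rewrite mxE /=; congr (_ * (_ * \det _)).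
  by apply/matrixP => r k; rewrite !mxE.
rewrite (bigID (fun y => [&& (z <= y)%O, (y <= x)%O & dim x == (dim y).+1])) /=.
rewrite [X in _ + X]big1 ?addr0 => [|y]; last first.
  apply: contraNeq; rewrite mulf_eq0 negb_or.
  by move=> /andP[/incidence_neq0[-> ->] /incidence_neq0[-> _]]; rewrite eqxx.
transitivity (\det (M (outward x z))); last first.
  have r1 : (1 < (dim z).+2)%N by [].
  by apply: (@determinant_alternate _ _ _ ord0 (Ordinal r1)) => // l; rewrite !mxE.
rewrite detM; under [RHS]eq_bigr => l _ do rewrite -(sum_outward l zx) mulr_suml.
rewrite exchange_big /=; apply: eq_bigr => y /and3P[zy yx /eqP dy].
rewrite -detM incidence_mul //; last by apply: succn_inj; rewrite -dy.
by rewrite dx.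
Qed.

End Square.

(** * Counting cohomology classes *)

(** Combines finiteness and pointwise addition, so that sets of cochains can be handled as subsets
    of a finite group. *)
HB.instance Definition _ (T : finType) (V : finZmodType) :=
  GRing.Zmodule.on {ffun T -> V}.

Lemma zmod_group_set (V : finZmodType) (G : {set V}) :
  0 \in G -> {in G &, forall x y, x + y \in G} -> group_set G.
Proof. by move=> G0 GD; apply/group_setP. Qed.

(** The sets counted are the cosets of [B] in [Z], so this is Lagrange's theorem. *)
Lemma card_quotient_zmod (V : finZmodType) (B Z : {set V}) :
  group_set B -> group_set Z -> B \subset Z ->
  (#|B| * #|[set [set (f + b)%R | b in B] | f in Z]|)%N = #|Z|.
Proof.
move=> gB gZ BZ; pose B' := Group gB; pose Z' := Group gZ.
by rewrite -(@Lagrange _ Z' B' BZ) -card_lcosets.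
Qed.

Lemma card_add_zmod (V : finZmodType) (G H K : {set V}) :
  group_set G -> group_set H -> {in G & H, forall g h, g + h \in K} ->
  (#|G| * #|H| <= #|G :&: H| * #|K|)%N.
Proof.
move=> gG gH GHK; rewrite (mul_cardG (Group gG) (Group gH)) mulnC leq_mul //.
by apply/subset_leq_card/subsetP => _ /mulsgP[g h gG' hH ->]; apply: GHK.
Qed.

(** * Cochains, cocycles and coboundaries of subcomplexes *)

Section Cohomology.
Variables (X : cubical_complex) (q : nat).
Implicit Types (P : {set X}) (f g : {ffun X -> 'Z_q}).

Lemma cochainsP k P f : reflect (forall x, x \notin cells_of_dim k P -> f x = 0)
  (f \in cochains q k P).
Proof.
rewrite inE; apply: (iffP forall_inP) => h x; first by move/h/eqP.
by move/h/eqP.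
Qed.

Lemma eq_cochains k P : skeleton X k \subset P ->
  cochains q k P = cochains q k setT.
Proof.
move=> /subsetP kP; have E : cells_of_dim k P = cells_of_dim k [set: X].
  apply/setP => x; rewrite !inE; case: (dim x =P k) => [dx|]; last by rewrite !andbF.
  by rewrite kP // inE dx.
by rewrite /cochains E.
Qed.

Lemma coboundary_subcomplex P f x : subcomplex P -> x \in P ->
  coboundary P f x = coboundary setT f x.
Proof.
move=> /forall_inP/(_ x) cP xP; rewrite !ffunE xP inE.
rewrite [RHS](bigID (mem P)) /=.
rewrite [X in _ + X]big1 ?addr0; first by apply: eq_bigl => y; rewrite inE.
move=> y /andP[_ yP]; apply/eqP; apply: contraNT yP => nz.
have /incidence_neq0[yx _] : incidence x y != 0.
  by apply: contraNneq nz => ->; rewrite mul0r.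
exact: (forall_inP (cP xP)).
Qed.

Lemma coboundary_outside k P f x : skeleton X k.+1 \subset P -> x \notin P ->
  f \in cochains q k setT -> coboundary setT f x = 0.
Proof.
move=> /subsetP kP xP /cochainsP f0; rewrite !ffunE inE big1 // => y _.
have [->|/incidence_neq0[_ dx]] := eqVneq (incidence x y) 0; first by rewrite mul0r.
rewrite f0 ?mulr0 // !inE /=; apply: contraNneq xP => dy.
by rewrite kP // inE dx dy.
Qed.

Lemma coboundary_coboundary f : coboundary setT (coboundary setT f) = 0.
Proof.
apply/ffunP => x; rewrite !ffunE inE.
transitivity (\sum_(y : X) \sum_(z : X) (incidence x y * incidence y z)%:~R * f z).
  apply: eq_big => [y|y _]; first by rewrite inE.
  rewrite ffunE inE mulr_sumr; apply: eq_big => [z|z _]; first by rewrite inE.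
  by rewrite intrM mulrA.
rewrite exchange_big big1 //= => z _.
by rewrite -mulr_suml -rmorph_sum sum_incidence_mul mul0r.
Qed.

Lemma coboundaryD P f g : coboundary P (f + g) = coboundary P f + coboundary P g.
Proof.
apply/ffunP => x; rewrite !ffunE; case: ifP => _; last by rewrite addr0.
by rewrite -big_split /=; apply: eq_bigr => y _; rewrite ffunE mulrDr.
Qed.

Lemma coboundary0 P : coboundary P (0 : {ffun X -> 'Z_q}) = 0.
Proof.
apply/ffunP => x; rewrite !ffunE; case: ifP => // _.
by rewrite big1 // => y _; rewrite ffunE mulr0.
Qed.

Lemma cochainsD k P f g : f \in cochains q k P -> g \in cochains q k P ->
  f + g \in cochains q k P.
Proof.
move=> /cochainsP f0 /cochainsP g0; apply/cochainsP => x xk.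
by rewrite ffunE f0 // g0 // addr0.
Qed.

Lemma cochains0 k P : 0 \in cochains q k P.
Proof. by apply/cochainsP => x _; rewrite ffunE. Qed.

Lemma group_set_cocycles k P : group_set (cocycles q k P).
Proof.
apply: zmod_group_set => [|f g].
  by apply/setIdP; rewrite cochains0 coboundary0 eqxx.
move=> /setIdP[fk /eqP f0] /setIdP[gk /eqP g0]; apply/setIdP.
by rewrite coboundaryD f0 g0 addr0 eqxx cochainsD.
Qed.

Lemma group_set_coboundaries k P : group_set (coboundaries q k P).
Proof.
case: k => [|k].
  by apply: zmod_group_set => [|_ _ /set1P-> /set1P->]; rewrite ?addr0 set11.
apply: zmod_group_set => [|_ _ /imsetP[f fk ->] /imsetP[g gk ->]].
  by rewrite -(coboundary0 P) imset_f ?cochains0.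
by rewrite -coboundaryD imset_f ?cochainsD.
Qed.

(** * Cohomology of percolation subcomplexes *)

Section Percolation.
Variable i : nat.

Lemma percolation_subcomplex P : is_percolation i P -> subcomplex P.
Proof. by case/and3P. Qed.

Lemma percolation_skeleton P k : is_percolation i P -> (k <= i.-1)%N ->
  skeleton X k \subset P.
Proof.
case/and3P => _ sP _ ki; apply: subset_trans sP; apply/subsetP => x.
by rewrite !inE => /leq_trans->.
Qed.

(** Here [P] enters only as the set where a coboundary taken in all of [X] has to vanish, which
    makes different subcomplexes comparable. *)
Lemma cocycles_percolation P f : is_percolation i P ->
  f \in cocycles q i.-1 P =
  (f \in cochains q i.-1 setT) && [forall x in P, coboundary setT f x == 0].
Proof.
move=> pP; rewrite in_set eq_cochains ?percolation_skeleton //.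
have cP := percolation_subcomplex pP.
congr (_ && _); apply/eqP/forall_inP => [f0 x xP|f0].
  by rewrite -(coboundary_subcomplex _ cP xP) f0 ffunE.
apply/ffunP => x; rewrite [RHS]ffunE; have [xP|xP] := boolP (x \in P).
  by rewrite coboundary_subcomplex //; apply/eqP/f0.
by rewrite ffunE (negPf xP).
Qed.

(** In positive degree, the cochains and the cells where their coboundaries can be nonzero live in
    the [i.-1]-skeleton, which [P] contains. *)
Lemma coboundaries_percolation P : is_percolation i P ->
  coboundaries q i.-1 P = coboundaries q i.-1 setT.
Proof.
move=> pP; have := percolation_skeleton pP; case: i.-1 => //= k sP.
rewrite (eq_cochains (sP k _)) //; apply: eq_in_imset => f fk.
apply/ffunP => x; have [xP|xP] := boolP (x \in P).
  exact: coboundary_subcomplex (percolation_subcomplex pP) xP.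
by rewrite (coboundary_outside (sP _ _) xP fk) // ffunE (negPf xP).
Qed.

Lemma coboundaries_sub_cocycles P : is_percolation i P ->
  coboundaries q i.-1 P \subset cocycles q i.-1 P.
Proof.
move=> pP; apply/subsetP => f; rewrite coboundaries_percolation //.
rewrite cocycles_percolation //; case: i.-1 => [|k] /=.
  rewrite inE => /eqP ->; rewrite cochains0 coboundary0 /=.
  by apply/forall_inP => x _; rewrite ffunE.
case/imsetP => g gk ->; rewrite coboundary_coboundary; apply/andP; split; last first.
  by apply/forall_inP => x _; rewrite ffunE.
apply/cochainsP => x; rewrite !inE /= => dx.
rewrite ffunE inE big1 // => y _.
have [->|/incidence_neq0[_ dy]] := eqVneq (incidence x y) 0; first by rewrite mul0r.
move/cochainsP: gk => ->; rewrite ?mulr0 // !inE /=.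
by apply: contraNneq dx => <-; rewrite dy.
Qed.

Lemma card_cohomology P : is_percolation i P ->
  (#|coboundaries q i.-1 [set: X]| * #|cohomology q i.-1 P|)%N =
  #|cocycles q i.-1 P|.
Proof.
move=> pP; rewrite -(coboundaries_percolation pP).
apply: card_quotient_zmod (coboundaries_sub_cocycles pP).
  exact: group_set_coboundaries.
exact: group_set_cocycles.
Qed.

Lemma is_percolationU P P' : is_percolation i P -> is_percolation i P' ->
  is_percolation i (P :|: P').
Proof.
move=> /and3P[c s t] /and3P[c' s' t']; apply/and3P; split.
- apply/forall_inP => x; rewrite inE => /orP[] xP; apply/forall_inP => y yx;
    rewrite inE.
    by rewrite (forall_inP (forall_inP c x xP) y yx).
  by rewrite (forall_inP (forall_inP c' x xP) y yx) orbT.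
- exact: subset_trans s (subsetUl _ _).
- by rewrite subUset t.
Qed.

Lemma is_percolationI P P' : is_percolation i P -> is_percolation i P' ->
  is_percolation i (P :&: P').
Proof.
move=> /and3P[c s t] /and3P[c' s' t']; apply/and3P; split.
- apply/forall_inP => x; rewrite inE => /andP[xP xP']; apply/forall_inP => y yx.
  by rewrite inE (forall_inP (forall_inP c x xP) y yx)
             (forall_inP (forall_inP c' x xP') y yx).
- by rewrite subsetI s.
- exact: subset_trans (subsetIl _ _) t.
Qed.

Lemma card_cohomology_supermodular P P' :
  is_percolation i P -> is_percolation i P' ->
  (#|cohomology q i.-1 P| * #|cohomology q i.-1 P'| <=
   #|cohomology q i.-1 (P :|: P')| * #|cohomology q i.-1 (P :&: P')|)%N.
Proof.
move=> pP pP'; have pU := is_percolationU pP pP'; have pI := is_percolationI pP pP'.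
set B := coboundaries q i.-1 [set: X].
have B_gt0 : (0 < #|B|)%N.
  by apply/card_gt0P; exists 0; apply: (group1 (Group (group_set_coboundaries i.-1 setT))).
(* Multiplying both sides by [#|B| * #|B|] turns the counts of classes into counts of cocycles. *)
have BB_gt0 : (0 < #|B| * #|B|)%N by rewrite muln_gt0 B_gt0.
rewrite -(leq_pmul2l BB_gt0) mulnACA [leqRHS]mulnACA.
rewrite !card_cohomology //.
have -> : cocycles q i.-1 (P :|: P') = cocycles q i.-1 P :&: cocycles q i.-1 P'.
  apply/setP => f; rewrite in_setI !cocycles_percolation // andbACA andbb.
  congr (_ && _); apply/forall_inP/andP => [h|[/forall_inP h /forall_inP h'] x].
    by split; apply/forall_inP => x xP; rewrite h // inE xP ?orbT.
  by rewrite inE => /orP[/h|/h'].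
apply: card_add_zmod; try exact: group_set_cocycles.
move=> f g; rewrite !cocycles_percolation // => /andP[fk /forall_inP f0] /andP[gk /forall_inP g0].
rewrite cochainsD //=; apply/forall_inP => x; rewrite inE => /andP[xP xP'].
by rewrite coboundaryD ffunE (eqP (f0 x xP)) (eqP (g0 x xP')) addr0.
Qed.

Lemma card_cells_of_dimUI k P P' :
  (#|cells_of_dim k (P :|: P')| + #|cells_of_dim k (P :&: P')| =
   #|cells_of_dim k P| + #|cells_of_dim k P'|)%N.
Proof.
rewrite -[RHS]cardsUI.
have -> : cells_of_dim k (P :|: P') = cells_of_dim k P :|: cells_of_dim k P'.
  by apply/setP => x; rewrite !inE andb_orl.
suff -> : cells_of_dim k (P :&: P') = cells_of_dim k P :&: cells_of_dim k P' by [].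
by apply/setP => x; rewrite !inE andbACA andbb.
Qed.

End Percolation.
End Cohomology.

(** * The four functions theorem *)

Section FourFunctions.
Variable R : realDomainType.

(** After removing the diagonal terms, [a0 * b1] and [a1 * b0] are each at most [u = c1 * d0], and
    their product is at most [u * v] with [v = c0 * d1]; this forces their sum to be at most
    [u + v]. *)
Lemma four_numbers (a0 a1 b0 b1 c0 c1 d0 d1 : R) :
  0 <= a0 -> 0 <= a1 -> 0 <= b0 -> 0 <= b1 ->
  0 <= c0 -> 0 <= c1 -> 0 <= d0 -> 0 <= d1 ->
  a0 * b0 <= c0 * d0 -> a0 * b1 <= c1 * d0 -> a1 * b0 <= c1 * d0 ->
  a1 * b1 <= c1 * d1 -> (a0 + a1) * (b0 + b1) <= (c0 + c1) * (d0 + d1).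
Proof.
move=> a0p a1p b0p b1p c0p c1p d0p d1p h00 h01 h10 h11.
suff : a0 * b1 + a1 * b0 <= c1 * d0 + c0 * d1 by move: h00 h11; lra.
have [u0|u_gt0] := leP (c1 * d0) 0.
  have : 0 <= c0 * d1 by rewrite mulr_ge0.
  have : 0 <= c1 * d0 by rewrite mulr_ge0.
  by move: h01 h10 u0; lra.
(* Regrouped, this bounds the product of the two cross terms by [u * v]. *)
have prod : (a0 * b0) * (a1 * b1) <= (c0 * d0) * (c1 * d1).
  by apply: ler_pM; rewrite ?mulr_ge0.
(* with u = c1 d0: (u - a0 b1) (u - a1 b0) >= 0 *)
have : 0 <= (c1 * d0 - a0 * b1) * (c1 * d0 - a1 * b0).
  by rewrite mulr_ge0 ?subr_ge0.
move=> prod'; rewrite -(ler_pM2l u_gt0) -subr_ge0.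
rewrite (_ : _ - _ = (c1 * d0 - a0 * b1) * (c1 * d0 - a1 * b0) +
  ((c0 * d0) * (c1 * d1) - (a0 * b0) * (a1 * b1))); last by ring.
by rewrite addr_ge0 // subr_ge0.
Qed.

Variable T : finType.

Lemma sum_subsetU1 (F : {set T} -> R) x (D : {set T}) : x \notin D ->
  \sum_(S : {set T} | S \subset x |: D) F S =
  \sum_(S : {set T} | S \subset D) (F S + F (x |: S)).
Proof.
move=> xD; rewrite (bigID (fun S : {set T} => x \in S)) /= addrC big_split /=.
have sub_notin (S : {set T}) : S \subset D -> x \notin S.
  by move=> /subsetP SD; apply: contra xD; apply: SD.
congr (_ + _).
  apply: eq_bigl => S; apply/andP/idP => [[SxD xS]|SD].
    by rewrite -(setU1K xD) subsetD1 SxD.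
  by rewrite (subset_trans SD) ?subsetUr // sub_notin.
rewrite (reindex_onto (fun S => x |: S) (fun S => S :\ x)) /=; last first.
  by move=> S /andP[_ xS]; rewrite setD1K.
apply: eq_bigl => S; rewrite setU11 andbT.
apply/andP/idP => [[SxD /eqP <-]|SD].
  by rewrite -(setU1K xD) setSD.
by rewrite setUS // setU1K ?sub_notin.
Qed.

(* The Ahlswede-Daykin inequality on a Boolean lattice. *)
Lemma four_functions (a b c d : {set T} -> R) :
  (forall S, 0 <= a S) -> (forall S, 0 <= b S) ->
  (forall S, 0 <= c S) -> (forall S, 0 <= d S) ->
  (forall S S', a S * b S' <= c (S :|: S') * d (S :&: S')) ->
  (\sum_S a S) * (\sum_S b S) <= (\sum_S c S) * (\sum_S d S).
Proof.
(* Induction on the size of [D], summing out one element [x] at a time. The hypothesis is restricted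
   to subsets of [D] because the summed functions satisfy it only for sets without [x]. *)
suff main n (D : {set T}) : #|D| = n ->
    forall a b c d : {set T} -> R,
    (forall S, 0 <= a S) -> (forall S, 0 <= b S) ->
    (forall S, 0 <= c S) -> (forall S, 0 <= d S) ->
    (forall S S' : {set T}, S \subset D -> S' \subset D ->
      a S * b S' <= c (S :|: S') * d (S :&: S')) ->
    (\sum_(S : {set T} | S \subset D) a S) * (\sum_(S : {set T} | S \subset D) b S)
    <= (\sum_(S : {set T} | S \subset D) c S) * (\sum_(S : {set T} | S \subset D) d S).
  move=> a0 b0 c0 d0 h.
  have := main _ _ (erefl #|[set: T]|) _ _ _ _ a0 b0 c0 d0 (fun S S' _ _ => h S S').
  by rewrite !(eq_bigl _ _ (@subsetT T)).
elim: n D => [|n IHn] D cD {}a {}b {}c {}d a0 b0 c0 d0 h.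
  rewrite (cards0_eq cD) !(eq_bigl _ _ (@subset0 T)) !big_pred1_eq.
  by have := h _ _ (sub0set D) (sub0set D); rewrite setU0 setI0.
have [x xD] : exists x, x \in D by apply/card_gt0P; rewrite cD.
have xD' : x \notin D :\ x by rewrite setD11.
have cD' : #|D :\ x| = n by have := cardsD1 x D; rewrite cD xD => -[].
rewrite -(setD1K xD) !sum_subsetU1 //; apply: IHn => // [S|S|S|S|S S' SD SD'];
  rewrite ?addr_ge0 //.
have nxS (U : {set T}) : U \subset D :\ x -> x \notin U.
  by move=> /subsetP UD; apply: contra xD'; apply: UD.
have xSD (U : {set T}) : U \subset D :\ x -> (U \subset D) /\ (x |: U \subset D).
  by move=> UD; split; rewrite ?subUset ?sub1set ?xD (subset_trans UD) ?subD1set.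
have [SD0 SD1] := xSD _ SD; have [S0 S1] := xSD _ SD'.
(* The index 0 or 1 tells whether the set contains [x]; a union contains it if either set does, an
   intersection if both do. *)
apply: four_numbers => //.
- exact: h.
- have -> : x |: (S :|: S') = S :|: (x |: S') by rewrite setUCA.
  have -> : S :&: S' = S :&: (x |: S').
    rewrite setIUr (_ : S :&: [set x] = set0) ?set0U //.
    by apply/disjoint_setI0; rewrite disjoint_sym disjoints1 nxS.
  exact: h.
- have -> : x |: (S :|: S') = (x |: S) :|: S' by rewrite setUA.
  have -> : S :&: S' = (x |: S) :&: S'.
    rewrite setIUl (_ : [set x] :&: S' = set0) ?set0U //.
    by apply/disjoint_setI0; rewrite disjoints1 nxS.
  exact: h.
- have -> : x |: (S :|: S') = (x |: S) :|: (x |: S') by rewrite setUACA setUid.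
  by rewrite setUIr; apply: h.
Qed.

(** Cutting [w] off by the indicators of the four families reduces to the full Boolean lattice; off
    [A] and [B] the left side is zero. *)
Lemma sum_mul_supermodular (w : {set T} -> R) (A B C D : {set {set T}}) :
  (forall S, 0 <= w S) ->
  {in A & B, forall S S', [/\ S :|: S' \in C, S :&: S' \in D &
     w S * w S' <= w (S :|: S') * w (S :&: S')]} ->
  (\sum_(S in A) w S) * (\sum_(S in B) w S) <=
  (\sum_(S in C) w S) * (\sum_(S in D) w S).
Proof.
move=> w0 h; have w0' (E : {set {set T}}) S : 0 <= if S \in E then w S else 0.
  by case: ifP.
have mk (E : {set {set T}}) :
  \sum_(S in E) w S = \sum_S (if S \in E then w S else 0) by apply: big_mkcond.
rewrite !mk; apply: (@four_functions
  (fun S => if S \in A then w S else 0) (fun S => if S \in B then w S else 0)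
  (fun S => if S \in C then w S else 0) (fun S => if S \in D then w S else 0))
  => // S S'.
case: ifP => SA; last by rewrite mul0r mulr_ge0.
case: ifP => SB; last by rewrite mulr0 mulr_ge0.
by have [-> ->] := h _ _ SA SB.
Qed.

End FourFunctions.

(** * Log-supermodularity of the random-cluster weight *)

Section Weight.
Variables (R : realType) (X : cubical_complex) (p : R) (q i : nat).
Hypothesis p01 : 0 <= p <= 1.

(** Extends [prc_weight] to arbitrary sets of cells, the Boolean lattice where the four functions
    theorem is proved. *)
Definition set_weight (P : {set X}) : R :=
  p ^+ #|cells_of_dim i P| *
  (1 - p) ^+ (#|cells_of_dim i [set: X]| - #|cells_of_dim i P|) *
  #|cohomology q i.-1 P|%:R.

Lemma set_weight_ge0 P : 0 <= set_weight P.
Proof.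
have /andP[p0 p1] := p01.
by rewrite !mulr_ge0 ?exprn_ge0 ?ler0n // subr_ge0.
Qed.

Lemma set_weight_supermodular (P P' : {set X}) :
  is_percolation i P -> is_percolation i P' ->
  set_weight P * set_weight P' <= set_weight (P :|: P') * set_weight (P :&: P').
Proof.
move=> pP pP'; have /andP[p0 p1] := p01.
rewrite /set_weight mulrACA [leRHS]mulrACA -!natrM.
have cU := card_cells_of_dimUI i P P'.
have sub (Q : {set X}) : (#|cells_of_dim i Q| <= #|cells_of_dim i [set: X]|)%N.
  by apply/subset_leq_card/subsetP => x; rewrite !inE => /andP[].
set n := #|cells_of_dim i [set: X]| in sub *.
(* The bounds [sub] guarantee that none of these natural subtractions truncates. *)
have eV : (n - #|cells_of_dim i (P :|: P')| + (n - #|cells_of_dim i (P :&: P')|) =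
    n - #|cells_of_dim i P| + (n - #|cells_of_dim i P'|))%N.
  have := sub P; have := sub P'; have := sub (P :|: P'); have := sub (P :&: P').
  by move: cU; clear; lia.
rewrite mulrACA [X in _ <= X * _]mulrACA -!exprD cU eV.
rewrite ler_wpM2l ?ler_nat ?card_cohomology_supermodular //.
by rewrite mulr_ge0 ?exprn_ge0 // subr_ge0.
Qed.

End Weight.

Theorem theorem24 (R : realType) (X : cubical_complex) (i q : nat) (p : R)
    (hi : (1 <= i)%N) (hq : (2 <= q)%N) (hp : 0 <= p <= 1)
    (A B : {set percolation X i}) :
  increasing A -> increasing B ->
  prc_measure p q (A :&: B) >= prc_measure p q A * prc_measure p q B.
Proof.
move=> incA incB; pose w := @set_weight R X p q i.
have sumE (E : {set percolation X i}) :
    \sum_(P in E) prc_weight p q P = \sum_(S in [set sval P | P in E]) w S.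
  by rewrite big_imset //= => P P' _ _; apply: val_inj.
set Z := \sum_(P : percolation X i) prc_weight p q P.
have ZE : Z = \sum_(S in [set sval P | P in [set: percolation X i]]) w S.
  by rewrite -sumE; apply: eq_bigl => P; rewrite inE.
have w0 S : 0 <= w S by apply: set_weight_ge0.
have Z0 : 0 <= Z by rewrite ZE sumr_ge0.
rewrite /prc_measure -/Z mulrACA -invfM.
(* Brings both sides to the denominator [Z * Z]; for [Z = 0] the convention on inverses makes both
   sides of this equation 0. *)
have -> : (\sum_(P in A :&: B) prc_weight p q P) / Z =
    (\sum_(P in A :&: B) prc_weight p q P) * Z / (Z * Z).
  have [->|Zn0] := eqVneq Z 0; first by rewrite !(mulr0, invr0).
  by rewrite invfM mulrA mulfK.
rewrite ler_wpM2r ?invr_ge0 ?mulr_ge0 //.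
(* Unions are sent to [A :&: B], as both events are increasing, and intersections to the family of
   all percolation subcomplexes, whose total weight is [Z]. *)
rewrite {1}ZE !sumE; apply: sum_mul_supermodular => //.
move=> _ _ /imsetP[P PA ->] /imsetP[P' PB ->]; split.
- have pU := is_percolationU (svalP P) (svalP P').
  apply/imsetP; exists (exist _ (sval P :|: sval P') pU : percolation X i) => //; apply/setIP; split.
    by apply: (incA P) PA _; apply: subsetUl.
  by apply: (incB P') PB _; apply: subsetUr.
- have pI := is_percolationI (svalP P) (svalP P').
  by apply/imsetP; exists (exist _ (sval P :&: sval P') pI : percolation X i).
- exact: set_weight_supermodular (svalP P) (svalP P').
Qed.
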